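(* Consider a stochastic one-sided full-information bandit with $K$ arms and rewards in $[0,1]$, with best arm $i^*$ and gaps $\Delta_i=\mu_{i^*}-\mu_i$. Let $\{\Delta_{(i)}\}$ be a permutation of $\{\Delta_i\mid i\le i^*\}$ such that $\Delta_{(1)}\ge\Delta_{(2)}\ge\dots\ge\Delta_{(i^* )}=0$, and let $C=8\ln(KT^2)$. Given the time horizon $T$, the (pseudo-)regret over $T$ rounds of the elimination algorithm ELIM run with time horizon $T$ is bounded by $$\Delta_{(1)}+\frac{C}{\Delta_{(1)}}+C\sum_{i=2}^{i^*-1}\left(\frac{1}{\Delta_{(i)}^2}-\frac{1}{\Delta_{(i-1)}^2}\right)\Delta_{(i)}+2 .$$
   Context: One-sided full-information bandit: there are $K$ arms $[K]=\{1,\dots,K\}$ and an unknown distribution $\nu$ with support $[0,1]^K$ (coordinates may be correlated); the reward distribution $\nu_i$ of arm $i$ is the $i$-th marginal of $\nu$. In each round $t=1,2,\dots$ a reward vector $X^{(t)}=(X^{(t)}_1,\dots,X^{(t)}_K)$ is drawn from $\nu$, independently across rounds. The player chooses an arm $I_t$ (based on past observations), gains $X^{(t)}_{I_t}$, and observes $X^{(t)}_i$ for all $i\ge I_t$. Write $\mu_i=\mathbb{E}[X^{(t)}_i]$ and let $i^*$ denote the best arm in expectation, i.e. $\mu_{i^*}\ge\mu_i$ for all $i\in[K]$. The pseudo-regret (called regret) over $T$ rounds is $\mathbb{E}[\sum_{t=1}^T (X^{(t)}_{i^*}-X^{(t)}_{I_t})]$ (equivalently $\mathbb{E}[\sum_{t=1}^T(\mu_{i^*}-\mu_{I_t})]$).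 Algorithm ELIM with time horizon $T$: set $S_0=[K]$ and $\hat\mu_{i,0}=0$ for all $i$. Let $\rho_1=\infty$ and $\rho_t=\sqrt{\frac{\ln(KT^2)}{2(t-1)}}$ for $t\ge 2$. For $t=1,\dots,T$: (1) let $m_{t-1}=\arg\max_{i\in S_{t-1}}\hat\mu_{i,t-1}$; (2) let $S_t=\{i\in S_{t-1}: \hat\mu_{m_{t-1},t-1}-\hat\mu_{i,t-1}\le 2\rho_t\}$; (3) play $I_t=\min S_t$ and observe $X_i^{(t)}$ for all $i\ge I_t$; (4) for all $i\in S_t$ set $\hat\mu_{i,t}=\hat\mu_{i,t-1}\cdot\frac{t-1}{t}+X_i^{(t)}\cdot\frac1t$ (so $\hat\mu_{i,t}=\frac1t\sum_{s=1}^t X_i^{(s)}$ for $i\in S_t$). *)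

(* Defs.v *)
From HB Require Import structures.
From mathcomp Require Import all_boot all_order all_algebra.
From mathcomp Require Import all_classical all_reals all_analysis.

Set Implicit Arguments.
Unset Strict Implicit.
Unset Printing Implicit Defensive.
Import Order.TTheory GRing.Theory Num.Theory.
Import numFieldNormedType.Exports.
Local Open Scope classical_set_scope.
Local Open Scope ring_scope.

(* MathComp-Analysis development.

   Arms 1, .., K are the elements 0, .., K - 1 of 'I_K. Rounds are numbered
   from 1 as usual: the value at 0 of a sequence indexed by rounds is either an
   initial value (S_0, muhat_0) or unused. A reward vector is a K.-tuple R,
   with the product sigma-algebra. *)

Section Rewards.
Context {R : realType} {K : nat}.

Definition rewards_in_unit_cube (nu : probability (K.-tuple R) R) : Prop :=
  nu [set x | forall i, 0 <= tnth x i <= 1] = 1%E.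

Definition mean (nu : probability (K.-tuple R) R) (i : 'I_K) : R :=
  \int[nu]_x tnth x i.

Definition gap (nu : probability (K.-tuple R) R) (istar i : 'I_K) : R :=
  mean nu istar - mean nu i.

Context {d : measure_display} {Omega : measurableType d}.

(* Mutual independence: the product rule over every finite set of rounds. The
   coordinates of one reward vector may be correlated. *)
Definition iid_rewards (P : probability Omega R)
    (nu : probability (K.-tuple R) R) (X : nat -> {RV P >-> K.-tuple R}) :
    Prop :=
  (forall t (A : set (K.-tuple R)), (0 < t)%N -> measurable A ->
     distribution P (X t) A = nu A) /\
  (forall (s : seq nat) (A : nat -> set (K.-tuple R)),
     uniq s -> (forall t, t \in s -> (0 < t)%N) ->
     (forall t, measurable (A t)) ->
     P (\bigcap_(t in [set` s]) X t @^-1` A t) =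
       (\prod_(t <- s) P (X t @^-1` A t))%E).

Definition regret (P : probability Omega R)
    (X : nat -> {RV P >-> K.-tuple R}) (istar : 'I_K)
    (I : Omega -> nat -> 'I_K) (T : nat) : \bar R :=
  'E_P[fun w => \sum_(1 <= t < T.+1)
                  (tnth (X t w) istar - tnth (X t w) (I w t))].

End Rewards.

Section Elim.
Context {R : realType} {K : nat}.

(* One-sided full information: playing [a] on reward vector [x] reveals the
   rewards of the arms [i >= a] and nothing else. *)
Definition feedback (a : 'I_K) (x : K.-tuple R) (i : 'I_K) : option R :=
  if (a <= i)%N then Some (tnth x i) else None.

Definition rho (T t : nat) : \bar R :=
  if (t <= 1)%N then +oo%E
  else (Num.sqrt (ln (K * T ^ 2)%N%:R / (2 * t.-1%:R)))%:E.

(* [elim_run T x S muhat m I]: the trajectory (S_t, muhat_{.,t}, m_t, I_t) is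
   an execution of ELIM with horizon T on the rewards x_1, .., x_T. Being a
   relation, it allows any choice among the maximizers, and leaves muhat t i
   unspecified for an arm i eliminated by round t. The default 0 in the update
   is never used, since i \in S t implies I t <= i. *)
Definition elim_run (T : nat) (x : nat -> K.-tuple R)
    (S : nat -> {set 'I_K}) (muhat : nat -> 'I_K -> R)
    (m : nat -> 'I_K) (I : nat -> 'I_K) : Prop :=
  [/\ S 0%N = [set: 'I_K]%SET,
      (forall i, muhat 0%N i = 0) &
      forall t, (1 <= t <= T)%N ->
      [/\ m t.-1 \in S t.-1 /\
          (forall j, j \in S t.-1 -> muhat t.-1 j <= muhat t.-1 (m t.-1)),
          S t = [set i in S t.-1 |
                  ((muhat t.-1 (m t.-1) - muhat t.-1 i)%:E
                     <= 2%:E * rho T t)%E]%SET,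
          I t \in S t /\ (forall j, j \in S t -> (I t <= j)%N) &
          forall i, i \in S t ->
            muhat t i = muhat t.-1 i * (t.-1%:R / t%:R)
                        + odflt 0 (feedback (I t) (x t) i) * t%:R^-1]].

End Elim.

Arguments rho {R} K T t.

Section Bound.
Context {R : realType} {K : nat}.

(* [delta] lists the gaps of the arms up to istar in nonincreasing order. *)
Definition sorted_gaps (nu : probability (K.-tuple R) R) (istar : 'I_K)
    (delta : seq R) : Prop :=
  perm_eq delta [seq gap nu istar i | i : 'I_K <- enum 'I_K & (i <= istar)%N] /\
  sorted >=%R delta.

(* Delta_(i), for i = 1, .., i^*. *)
Definition ordgap (delta : seq R) (i : nat) : R := delta`_i.-1.

(* The ordinal istar is the arm numbered i^* = istar.+1, whence the range
   2 <= i <= i^* - 1 of the sum. As 0^-1 = 0, the terms in which Delta_(i) = 0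
   vanish, and so does C / Delta_(1) when no arm before i^* is suboptimal. *)
Definition elim_bound (istar : 'I_K) (delta : seq R) (T : nat) : R :=
  let C := 8 * ln (K * T ^ 2)%N%:R in
  ordgap delta 1 + C / ordgap delta 1
  + C * \sum_(2 <= i < istar.+1)
          (1 / ordgap delta i ^+ 2 - 1 / ordgap delta i.-1 ^+ 2)
          * ordgap delta i
  + 2.

End Bound.

(* Main.v *)
(** Hoeffding's inequality and a union bound over the arms and the rounds n < T
    show that, outside an event of probability at most 2 / T, every empirical
    mean of n observations is within sqrt (ln (K T^2) / (2 n)) of its
    expectation. Outside that event arm i^* is never eliminated, so I_t <= i^*,
    and the arm played in round n + 1 has a gap Delta with n Delta^2 <= C. A gap
    Delta_(l) is the sum of Delta_(j) - Delta_(j+1) over j >= l, and at most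
    C / Delta_(j)^2 of the rounds n + 1 with n >= 1 have gap at least Delta_(j);
    summation by parts turns the resulting bound into the stated one. The
    exceptional event costs at most T * (2 / T). The realized regret has the same
    expectation as the sum of the gaps of the played arms because the event
    I_t = a depends on X_1, .., X_{t-1} only, hence is independent of X_t. *)

Require Import Defs.
From HB Require Import structures.
From mathcomp Require Import all_boot all_order all_algebra.
From mathcomp Require Import all_classical all_reals all_analysis.
From mathcomp Require Import measurable_realfun ring lra.
Set Implicit Arguments.
Unset Strict Implicit.
Unset Printing Implicit Defensive.
Import Order.TTheory GRing.Theory Num.Theory.
Import numFieldNormedType.Exports.
Local Open Scope classical_set_scope.
Local Open Scope ring_scope.

(** * Sums of gaps *)

Section GapSums.
Context {R : realType}.
Implicit Types (delta : seq R) (C c : R).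

(** Indices past the end read the default 0, which lies below every entry of a nonnegative list, so
    the order extends to all indices. *)
Lemma nth_sorted_antitone delta :
  sorted >=%R delta -> {in delta, forall x, 0 <= x} ->
  forall i j, (i <= j)%N -> delta`_j <= delta`_i.
Proof.
move=> sd d0 i j ij; have [jd|jd] := ltnP j (size delta); last first.
  rewrite (nth_default _ jd); have [id|id] := ltnP i (size delta).
    by rewrite d0 ?mem_nth.
  by rewrite nth_default.
apply: (sorted_leq_nth ge_trans ge_refl 0 sd) => //.
by rewrite inE (leq_ltn_trans ij).
Qed.

(** Applied with [c] = C / Delta^2, this counts the rounds whose gap is at least Delta. *)
Lemma count_nat_le c n : 0 <= c -> \sum_(1 <= s < n.+1) (s%:R <= c)%R%:R <= c.
Proof.
move=> c0; elim: n => [|n IH]; first by rewrite big_geq.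
rewrite big_nat_recr //=.
case: (leP n.+1%:R c) => [nc|_]; last by rewrite addr0.
apply: le_trans nc; rewrite -[leRHS]natr1 lerD2r.
have -> : n%:R = \sum_(1 <= s < n.+1) 1 :> R by rewrite sumr_const_nat subn1.
by apply: ler_sum => s _; rewrite -[1]/(1%:R) ler_nat leq_b1.
Qed.

(** Abel summation, used with [v j] the inverse square of [u j] and a vanishing boundary term. *)
Lemma sum_by_parts (u v : nat -> R) k :
  \sum_(0 <= j < k.+1) (u j - u j.+1) * v j =
  u 0 * v 0 + \sum_(1 <= j < k.+1) (v j - v j.-1) * u j - u k.+1 * v k.
Proof.
elim: k => [|k IH]; first by rewrite big_nat1 big_geq //=; ring.
by rewrite big_nat_recr //= IH [in RHS]big_nat_recr //=; ring.
Qed.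

Lemma sum_sorted_gaps delta k C n (g : nat -> R) :
  sorted >=%R delta -> {in delta, forall x, 0 <= x} -> delta`_k = 0 -> 0 <= C ->
  (forall s, (1 <= s <= n)%N -> g s \in delta /\ s%:R * g s ^+ 2 <= C) ->
  \sum_(1 <= s < n.+1) g s <= C / ordgap delta 1
    + C * \sum_(2 <= i < k.+1)
          (1 / ordgap delta i ^+ 2 - 1 / ordgap delta i.-1 ^+ 2)
          * ordgap delta i.
Proof.
move=> sd d0 dk C0 hg; pose u := nth 0 delta; pose v j := (u j ^+ 2)^-1.
have dec := nth_sorted_antitone sd d0.
have u0 j : 0 <= u j.
  rewrite /u; have [jd|jd] := ltnP j (size delta); first by rewrite d0 ?mem_nth.
  by rewrite nth_default.
(* The target becomes a sum over levels: the drop from [u j] to [u j.+1], times the bound C /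
   [u j]^2 on the number of rounds that reach level [j]. *)
have -> : C / ordgap delta 1 + C * \sum_(2 <= i < k.+1)
    (1 / ordgap delta i ^+ 2 - 1 / ordgap delta i.-1 ^+ 2) * ordgap delta i
  = \sum_(0 <= j < k) (u j - u j.+1) * (C * v j).
  case: k dk => [|k] dk.
    rewrite !big_geq // mulr0 addr0.
    by rewrite /ordgap /= dk invr0 mulr0.
  under [in RHS]eq_bigr do rewrite mulrCA.
  rewrite -mulr_sumr sum_by_parts [u k.+1]dk mul0r subr0 mulrDr; congr (_ + _ * _).
    rewrite /ordgap /= /v -/(u 0%N); congr (_ * _).
    have [->|u00] := eqVneq (u 0%N) 0; first by rewrite invr0 mul0r.
    by field.
  rewrite big_add1 /=; apply: eq_big_nat => i /andP[i1 ik].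
  by rewrite /ordgap /v !div1r; case: i i1 ik.
(* With [g s] = [u l], the drops from [l] up to [k] telescope to [u l], since [u k] = 0. Levels
   before [l] only add nonnegative terms; for [k <= l] the gap [g s] is at most [u k] = 0. *)
have stepE s : (1 <= s <= n)%N ->
    g s <= \sum_(0 <= j < k) (u j - u j.+1) * (u j <= g s)%R%:R.
  move=> /hg[/(nthP 0)[l ld] gl _]; rewrite -gl -/(u l).
  have [kl|lk] := leqP k l.
    apply: (@le_trans _ _ 0); first by rewrite -dk dec.
    by apply: sumr_ge0 => j _; rewrite mulr_ge0 // subr_ge0 dec.
  rewrite (big_cat_nat _ (ltnW lk)) //=; rewrite -[leLHS]add0r lerD //.
    by apply: sumr_ge0 => j _; rewrite mulr_ge0 // subr_ge0 dec.
  rewrite -[leLHS]subr0 -[X in _ - X <= _]dk -opprB -telescope_sumr 1?ltnW // -sumrN.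
  apply: ler_sum_nat => j /andP[lj jk].
  by rewrite opprB (dec _ _ lj) mulr1.
apply: (@le_trans _ _ (\sum_(1 <= s < n.+1)
    \sum_(0 <= j < k) (u j - u j.+1) * (u j <= g s)%R%:R)).
  by apply: ler_sum_nat => s sn; exact: stepE.
rewrite exchange_big /=; apply: ler_sum_nat => j _; rewrite -mulr_sumr.
(* When [u j] = 0, the quotient C / [u j]^2 reads as 0 and bounds no count, but the drop is then 0
   as well. *)
have [uj|uj] := eqVneq (u j) 0.
  have -> : u j - u j.+1 = 0; last by rewrite !mul0r.
  by rewrite uj sub0r; apply/eqP; rewrite oppr_eq0 eq_le u0 andbT -uj dec.
have uj_gt0 : 0 < u j by rewrite lt_def uj u0.
apply: ler_wpM2l; first by rewrite subr_ge0 dec.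
apply: (le_trans _ (count_nat_le n _)); last first.
  by rewrite mulr_ge0 // invr_ge0 exprn_ge0.
(* A counted round has [u j <= g s], so s [u j]^2 <= s [g s]^2 <= C. *)
apply: ler_sum_nat => s /hg[_ sC]; rewrite -[X in _ <= X]/((_ : nat)%:R) ler_nat.
case: leP => // ug; rewrite lt0b /v ler_pdivlMr ?exprn_gt0 //.
apply: le_trans sC; apply: ler_wpM2l => //.
by rewrite ler_pXn2r // nnegrE ?(le_trans _ ug).
Qed.

End GapSums.

(** * Hoeffding's lemma for a Bernoulli variable *)

Section HoeffdingScalar.
Context {R : realType}.

Lemma ge0_of_derive_ge0 (f f' : R -> R) (x : R) : f 0 = 0 ->
  (forall y : R, 0 <= y -> is_derive y 1 f (f' y)) ->
  (forall y : R, 0 <= y -> 0 <= f' y) -> 0 <= x -> 0 <= f x.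
Proof.
move=> f0 df f'0 x0; rewrite -{1}f0.
apply: (@ger0_derive1_le_cc R f 0 x) => //; rewrite ?bound_itvE //.
- by move=> y; rewrite in_itv /= => /andP[/ltW /df [dfy]].
- move=> y; rewrite in_itv /= => /andP[/ltW y0 _].
  by have [? e] := df _ y0; rewrite derive1E e f'0.
apply: continuous_in_subspaceT => y; rewrite inE /= in_itv /= => /andP[y0 _].
by apply: differentiable_continuous; apply/derivable1_diffP; have [] := df _ y0.
Qed.

(** [F], the exponent on the right minus the logarithm of the left side, has F(0) = F'(0) = 0 and
    F'' >= 0, so two applications of [ge0_of_derive_ge0] make it nonnegative. *)
Lemma hoeffding_scalar (p x : R) : 0 <= p <= 1 -> 0 <= x ->
  1 - p + p * expR x <= expR (x * p + x ^+ 2 / 8).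
Proof.
move=> /andP[p0 p1] x0; pose q (y : R) := 1 - p + p * expR y.
have q0 (y : R) : 0 < q y.
  rewrite /q; have [->|pn0] := eqVneq p 0; first by rewrite subr0 mul0r addr0.
  by rewrite ltr_wpDl ?subr_ge0 // mulr_gt0 ?expR_gt0 // lt_def pn0.
have dq (y : R) : is_derive y 1 q (p * expR y).
  by rewrite /q; apply: is_derive_eq; rewrite /GRing.scale /=; ring.
pose F (y : R) := y * p + y ^+ 2 / 8 - ln (q y).
pose F' (y : R) := p + y / 4 - p * expR y / q y.
(* F'' is nonnegative by AM-GM on the two terms of q. *)
pose F'' (y : R) := 4^-1 - p * (1 - p) * expR y / q y ^+ 2.
have dF' (y : R) : is_derive y 1 F' (F'' y).
  have qn0 : q y != 0 by rewrite gt_eqF.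
  have dqV : is_derive y 1 (fun y : R => (q y)^-1) (- (q y) ^- 2 *: (p * expR y)).
    exact: is_deriveV.
  rewrite /F' /F''; apply: is_derive_eq; rewrite /GRing.scale /=.
  by rewrite /q in qn0 *; field.
have dF (y : R) : is_derive y 1 F (F' y).
  have qn0 : q y != 0 by rewrite gt_eqF.
  have dl : is_derive y 1 (@ln R \o q) ((p * expR y) * (q y)^-1).
    rewrite mulrC; apply: is_derive1_comp => //.
    exact: is_derive1_ln.
  rewrite /F /F'; apply: is_derive_eq; rewrite /GRing.scale /=.
  by field.
have F''0 (y : R) : 0 <= F'' y.
  rewrite /F'' subr_ge0 ler_pdivrMr ?exprn_gt0 // -subr_ge0.
  suff -> : 4^-1 * q y ^+ 2 - p * (1 - p) * expR y
    = 4^-1 * (1 - p - p * expR y) ^+ 2 by rewrite mulr_ge0 // sqr_ge0.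
  by rewrite /q; field.
have F'0 (y : R) : 0 <= y -> 0 <= F' y.
  apply: (@ge0_of_derive_ge0 F' F'' y) => //.
  by rewrite /F' /q expR0; field; rewrite subrK oner_neq0.
have F0 : 0 <= F x.
  apply: (@ge0_of_derive_ge0 F F' x) => //.
  by rewrite /F /q expR0 mulr1 subrK ln1; ring.
have -> : 1 - p + p * expR x = expR (ln (q x)) by rewrite lnK // posrE.
by rewrite ler_expR -subr_ge0.
Qed.

(* Factoring out [expR (l * x)] reduces the chord bound to [1 + y <= expR y] at
   the two endpoints. *)
Lemma expR_le_chord (l x : R) : 0 <= x <= 1 ->
  expR (l * x) <= 1 - x + x * expR l.
Proof.
move=> /andP[x0 x1].
have -> : 1 - x + x * expR l =
    expR (l * x) * ((1 - x) * expR (- (l * x)) + x * expR (l * (1 - x))).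
  rewrite mulrDr mulrCA -expRD subrr expR0 mulr1 mulrCA -expRD.
  by congr (_ + _ * expR _); ring.
rewrite -[leLHS]mulr1 ler_wpM2l ?expR_ge0 //.
have e1 := @expR_ge1Dx R (- (l * x)); have e2 := @expR_ge1Dx R (l * (1 - x)).
(* The linear terms (1 - x) (- l x) and x l (1 - x) cancel, so the two lower bounds add up to 1. *)
have := lerD (ler_wpM2l (_ : 0 <= 1 - x) e1) (ler_wpM2l x0 e2).
by rewrite subr_ge0 => /(_ x1); apply: le_trans; lra.
Qed.

End HoeffdingScalar.

(** * Independence of the past and the next observation *)

Section IndependentPair.
Context {R : realType} {d d1 d2 : measure_display} {Omega : measurableType d}
  {H : measurableType d1} {V : measurableType d2}
  (P : probability Omega R) (nu : probability V R)
  (Z : {mfun Omega >-> H}) (W : {mfun Omega >-> V}).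
Hypothesis ZW_indep : forall A B, measurable A -> measurable B ->
  P (Z @^-1` A `&` W @^-1` B) = (P (Z @^-1` A) * nu B)%E.
Local Open Scope ereal_scope.

(** The product rule on rectangles identifies the law of [(Z, W)] with the product of the law of [Z]
    and [nu]; Tonelli then factors the integral. *)
Lemma indep_ge0_expectation (Y : H -> R) (g : V -> R) :
  measurable_fun setT Y -> measurable_fun setT g ->
  (forall w, 0 <= Y w)%R -> (forall x, 0 <= g x)%R ->
  \int[P]_w (Y (Z w) * g (W w))%:E =
    \int[P]_w (Y (Z w))%:E * \int[nu]_x (g x)%:E.
Proof.
move=> mY mg Y0 g0.
have mpair : measurable_fun setT (fun w => (Z w, W w)).
  exact: measurable_fun_pair.
pose pairm : {mfun Omega >-> (H * V)%type} :=
  HB.pack (fun w => (Z w, W w)) (isMeasurableFun.Build _ _ _ _ _ mpair).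
pose f (z : H * V) := (Y z.1 * g z.2)%:E.
have mf : measurable_fun setT f.
  apply/measurable_EFinP/measurable_funM.
    exact: (measurableT_comp mY measurable_fst).
  exact: (measurableT_comp mg measurable_snd).
have f0 z : 0 <= f z by rewrite lee_fin mulr_ge0.
have -> : \int[P]_w (Y (Z w) * g (W w))%:E =
    \int[distribution P Z \x nu]_z f z.
  transitivity (\int[distribution P pairm]_z f z).
    by rewrite ge0_integral_distribution.
  apply: eq_measure_integral => A mA _; apply/esym.
  apply: product_measure_unique mA => B C mB mC.
  exact: ZW_indep.
rewrite (fubini_tonelli1 f) //.
transitivity (\int[distribution P Z]_w ((Y w)%:E * \int[nu]_x (g x)%:E)).
  apply: eq_integral => w _; rewrite /fubini_F /f /=.
  under eq_integral do rewrite EFinM.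
  rewrite ge0_integralZl_EFin //; first by move=> x _; rewrite lee_fin.
  exact/measurable_EFinP.
rewrite ge0_integralZr //; last by apply: integral_ge0 => x _; rewrite lee_fin.
- rewrite ge0_integral_distribution //; first exact/measurable_EFinP.
- exact/measurable_EFinP.
- by move=> w _; rewrite lee_fin.
Qed.

End IndependentPair.

Section History.
Context {R : realType} {d d' : measure_display} {Omega : measurableType d}
  {V : measurableType d'} (P : probability Omega R) (nu : probability V R)
  (X : nat -> {RV P >-> V}).
Hypothesis X_law : forall t (A : set V), (0 < t)%N -> measurable A ->
  distribution P (X t) A = nu A.
Hypothesis X_indep : forall (s : seq nat) (A : nat -> set V),
  uniq s -> (forall t, t \in s -> (0 < t)%N) -> (forall t, measurable (A t)) ->
  P (\bigcap_(t in [set` s]) X t @^-1` A t) =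
    (\prod_(t <- s) P (X t @^-1` A t))%E.

(** A pi-system generating the information of rounds 1 to n. The constraints [A] are indexed by all
    naturals, but only the indices 1 to n are read. *)
Definition cylinder (n : nat) : set (set Omega) :=
  [set E | exists2 A : nat -> set V, (forall t, measurable (A t)) &
     E = \bigcap_(t in [set` iota 1 n]) X t @^-1` A t].

(* [Omega] with the sigma-algebra generated by X_1, .., X_n. *)
Local Notation history n := (g_sigma_algebraType (cylinder n)).

Lemma cylinderI n : setI_closed (cylinder n).
Proof.
move=> _ _ [A mA ->] [B mB ->]; exists (fun t => A t `&` B t).
  by move=> t; exact: measurableI.
by rewrite -bigcapI; apply: eq_bigcapr => t _; rewrite preimage_setI.
Qed.

Lemma cylinderT n : cylinder n setT.
Proof.
exists (fun=> setT) => //; apply/esym; rewrite -subTset => w _ t _; exact: I.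
Qed.

Lemma cylinder_measurable n : cylinder n `<=` measurable.
Proof.
move=> _ [A mA ->]; apply: bigcap_measurableType => t _.
exact: measurable_funPTI.
Qed.

Lemma history_measurable n : <<s cylinder n >> `<=` measurable.
Proof.
apply: smallest_sub; first exact: sigma_algebra_measurable.
exact: cylinder_measurable.
Qed.

Lemma measurable_history_reward n t : (0 < t <= n)%N ->
  measurable_fun [set: history n] (X t : history n -> V).
Proof.
move=> /andP[t0 tn] _ B mB; rewrite setTI; apply: sub_sigma_algebra.
exists (fun s => if s == t then B else setT); first by move=> s; case: eqP.
apply/seteqP; split => [w Bw s _|w /(_ t)]; first by rewrite /=; case: eqP => // ->.
by rewrite /= eqxx; apply; rewrite mem_iota t0 add1n ltnS.
Qed.

(** The intersection is again a cylinder, over n + 1 rounds and with [B] as the last constraint, so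
    the product rule applies to it as well as to [E]. *)
Lemma cylinder_indep n E (B : set V) : cylinder n E -> measurable B ->
  P (E `&` X n.+1 @^-1` B) = (P E * nu B)%E.
Proof.
move=> [A mA ->] mB; pose A' t := if t == n.+1 then B else A t.
have mA' t : measurable (A' t) by rewrite /A'; case: eqP.
have pos m : forall t, t \in iota 1 m -> (0 < t)%N.
  by move=> t; rewrite mem_iota => /andP[].
have A'E t : t \in iota 1 n -> A' t = A t.
  by rewrite mem_iota add1n ltnS /A' => /andP[_ tn]; rewrite ltn_eqF.
have iotaS : iota 1 n.+1 = rcons (iota 1 n) n.+1.
  by rewrite -cats1 -[in LHS](addn1 n) iotaD add1n.
have -> : \bigcap_(t in [set` iota 1 n]) X t @^-1` A t `&` X n.+1 @^-1` B =
    \bigcap_(t in [set` iota 1 n.+1]) X t @^-1` A' t.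
  rewrite iotaS; apply/seteqP; split => [w [Aw Bw] t /=|w Aw].
    rewrite mem_rcons inE => /predU1P[->|tn]; first by rewrite /A' eqxx.
    by rewrite A'E //; exact: Aw.
  split => [t /= tn|]; last first.
    by have := Aw n.+1; rewrite /A' /= eqxx; apply; rewrite mem_rcons mem_head.
  by rewrite -A'E //; apply: Aw; rewrite /= mem_rcons inE tn orbT.
rewrite !X_indep ?iota_uniq //; try exact: pos.
rewrite iotaS -cats1 big_cat big_seq1 /= {2}/A' eqxx; congr (_ * _)%E.
  by apply: eq_big_seq => t tn; rewrite A'E.
exact: X_law.
Qed.

(** For fixed [B] both sides are finite measures in [E]; they agree on the pi-system of cylinders,
    hence on the sigma-algebra it generates. *)
Lemma history_indep n E (B : set V) : <<s cylinder n >> E -> measurable B ->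
  P (E `&` X n.+1 @^-1` B) = (P E * nu B)%E.
Proof.
move=> mE mB.
have mXB : measurable (X n.+1 @^-1` B) by exact: measurable_funPTI.
have fB : nu B \is a fin_num by exact: fin_num_measure.
have b0 : 0 <= fine (nu B) by rewrite fine_ge0.
have := @g_sigma_algebra_measure_unique d R Omega (cylinder n)
  (@cylinder_measurable n) (fun=> setT) (fun=> @cylinderT n) _
  (mrestr P mXB) (mscale (NngNum b0) P) (@cylinderI n).
move=> /(_ _ _ _ E mE) /=; rewrite /mrestr /mscale /= => -> //.
- by rewrite muleC fineK.
- by rewrite bigcup_const //; exists 0%N.
- by move=> A cA; rewrite cylinder_indep // fineK // muleC.
- move=> _; rewrite setTI; apply: le_lt_trans (ltry 1).
  exact: probability_le1.
Qed.

Local Open Scope ereal_scope.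

(** The past is encoded as the identity map into Omega with the coarser sigma-algebra, so that any
    history-measurable [Y] is a function of it. *)
Lemma history_ge0_expectation n (Y : history n -> R) (g : V -> R) :
  measurable_fun setT Y -> measurable_fun setT g ->
  (forall w, 0 <= Y w)%R -> (forall x, 0 <= g x)%R ->
  \int[P]_w (Y w * g (X n.+1 w))%:E =
    \int[P]_w (Y w)%:E * \int[nu]_x (g x)%:E.
Proof.
move=> mY mg Y0 g0; pose emb (w : Omega) : history n := w.
have memb : measurable_fun setT emb.
  move=> _ B mB; rewrite setTI; apply: (@history_measurable n); exact: mB.
pose embm : {mfun Omega >-> history n} :=
  HB.pack emb (isMeasurableFun.Build _ _ _ _ _ memb).
apply: (@indep_ge0_expectation _ _ _ _ _ _ _ P nu embm (X n.+1)) => //.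
by move=> A B mA mB; exact: history_indep.
Qed.

End History.

(** * Hoeffding's inequality *)

Section UnitInterval.
Context {R : realType} {d : measure_display} {V : measurableType d}
  (nu : probability V R) (h : V -> R).
Hypothesis mh : measurable_fun setT h.

Lemma integrable_ae_unit : {ae nu, forall x, 0 <= h x <= 1} ->
  nu.-integrable setT (EFin \o h).
Proof.
move=> h01; apply/integrableP; split; first exact/measurable_EFinP.
apply: (@le_lt_trans _ _ (\int[nu]_x (cst 1%E) x)%E); last first.
  by rewrite integral_cst //= mul1e probability_setT ltry.
apply: ae_ge0_le_integral => //.
  by apply: measurableT_comp => //; exact/measurable_EFinP.
apply: filterS h01 => x /andP[h0 h1] _ /=.
by rewrite lee_fin ger0_norm.
Qed.

Lemma mean_unit : (forall x, 0 <= h x <= 1) -> 0 <= \int[nu]_x h x <= 1.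
Proof.
move=> h01; have ih := integrable_ae_unit (aeW nu h01).
have pE : (\int[nu]_x (h x)%:E = (\int[nu]_x h x)%:E)%E.
  by rewrite /Rintegral fineK //; exact: (integrable_fin_num measurableT ih).
apply/andP; split; rewrite -lee_fin -pE.
  by apply: integral_ge0 => x _; rewrite lee_fin; have /andP[] := h01 x.
have <- : (\int[nu]_x cst 1 x = 1)%E.
  by rewrite integral_cst //= mul1e probability_setT.
apply: ge0_le_integral => //.
- by move=> x _; rewrite lee_fin; have /andP[] := h01 x.
- exact/measurable_EFinP.
- by move=> x _; rewrite lee_fin; have /andP[] := h01 x.
Qed.

(** The chord bound replaces the exponential by an affine function of [h], whose integral depends on
    the mean [p] alone and is controlled by [hoeffding_scalar]. *)
Lemma hoeffding_mgf_unit l : (forall x, 0 <= h x <= 1) -> 0 <= l ->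
  (\int[nu]_x (expR (l * (h x - \int[nu]_x h x)))%:E
     <= (expR (l ^+ 2 / 8))%:E)%E.
Proof.
move=> h01 l0; have ih := integrable_ae_unit (aeW nu h01).
have h0 x : 0 <= h x by have /andP[] := h01 x.
have el0 : 0 <= expR l - 1 by rewrite subr_ge0 -[leLHS]expR0 ler_expR.
have pE : (\int[nu]_x (h x)%:E = (\int[nu]_x h x)%:E)%E.
  by rewrite /Rintegral fineK //; exact: (integrable_fin_num measurableT ih).
have p01 := mean_unit h01.
set p := \int[nu]_x h x in pE p01 *.
apply: (@le_trans _ _
    (\int[nu]_x (expR (- (l * p)) * (1 + (expR l - 1) * h x))%:E)%E).
  apply: ge0_le_integral => //.
  - apply/measurable_EFinP/measurableT_comp => //; apply: measurable_funM => //.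
    exact: measurable_funB.
  - apply/measurable_EFinP/measurable_funM => //; apply: measurable_funD => //.
    exact: measurable_funM.
  - move=> x _; rewrite lee_fin mulrBr addrC expRD ler_wpM2l ?expR_ge0 //.
    by apply: le_trans (expR_le_chord l (h01 x)) _; lra.
under eq_integral do rewrite EFinM.
rewrite ge0_integralZl_EFin ?expR_ge0 //; last 2 first.
- by move=> x _; rewrite lee_fin addr_ge0 ?mulr_ge0.
- apply/measurable_EFinP/measurable_funD => //; exact: measurable_funM.
under eq_integral do rewrite EFinD EFinM.
rewrite ge0_integralD //; last 2 first.
- by move=> x _; rewrite -EFinM lee_fin mulr_ge0.
- by apply/measurable_EFinP/measurable_funM.
rewrite ge0_integralZl_EFin //; last 2 first.
- by move=> x _; rewrite lee_fin.
- exact/measurable_EFinP.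
rewrite pE integral_cst //= probability_setT mule1.
rewrite -[leLHS]/((expR (- (l * p)) * (1 + (expR l - 1) * p))%:E) lee_fin.
have := hoeffding_scalar p01 l0.
rewrite expRD => /(ler_wpM2l (expR_ge0 (- (l * p)))).
rewrite mulrA -expRD addNr expR0 mul1r; apply: le_trans.
by rewrite ler_wpM2l ?expR_ge0 //; lra.
Qed.

End UnitInterval.

(* Rewards lie in [0, 1] only almost surely; clipping makes that hold
   everywhere. *)
Definition clip01 {R : realType} (x : R) : R := Num.min 1 (Num.max 0 x).

Lemma clip01_unit {R : realType} (x : R) : 0 <= clip01 x <= 1.
Proof. by rewrite /clip01 le_min ler01 le_max lexx ge_min lexx. Qed.

Lemma clip01_id {R : realType} (x : R) : 0 <= x <= 1 -> clip01 x = x.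
Proof. by move=> /andP[x0 x1]; rewrite /clip01 max_r // min_r. Qed.

Lemma measurable_clip01 {R : realType} {d : measure_display}
    {V : measurableType d} (h : V -> R) :
  measurable_fun setT h -> measurable_fun setT (clip01 \o h).
Proof.
by move=> mh; apply: measurable_minr => //; exact: measurable_maxr.
Qed.

Lemma hoeffding_mgf {R : realType} {d : measure_display} {V : measurableType d}
    (nu : probability V R) (h : V -> R) l :
  measurable_fun setT h -> {ae nu, forall x, 0 <= h x <= 1} -> 0 <= l ->
  (\int[nu]_x (expR (l * (h x - \int[nu]_x h x)))%:E
     <= (expR (l ^+ 2 / 8))%:E)%E.
Proof.
move=> mh h01 l0; have mc := measurable_clip01 mh.
have hc : {ae nu, forall x, h x = clip01 (h x)}.
  by apply: filterS h01 => x hx; rewrite clip01_id.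
have -> : \int[nu]_x h x = \int[nu]_x clip01 (h x).
  congr fine; apply: ae_eq_integral => //; [exact/measurable_EFinP..|].
  by apply: filterS hc => x hx _ /=; rewrite -hx.
have mexp (g : V -> R) c : measurable_fun setT g ->
    measurable_fun setT (fun x => (expR (l * (g x - c)))%:E).
  move=> mg; apply/measurable_EFinP/measurableT_comp => //.
  by apply: measurable_funM => //; exact: measurable_funB.
rewrite (@ae_eq_integral _ _ _ nu setT
  (fun x => (expR (l * (clip01 (h x) - \int[nu]_x clip01 (h x))))%:E)) //.
- exact: (@hoeffding_mgf_unit _ _ _ nu _ mc l (fun x => clip01_unit (h x)) l0).
- exact: mexp.
- exact: (mexp (clip01 \o h)).
- by apply: filterS hc => x hx _ /=; rewrite -hx.
Qed.

Section HistoryBounds.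
Context {R : realType} {d d' : measure_display} {Omega : measurableType d}
  {V : measurableType d'} (P : probability Omega R) (nu : probability V R)
  (X : nat -> {RV P >-> V}).
Hypothesis X_law : forall t (A : set V), (0 < t)%N -> measurable A ->
  distribution P (X t) A = nu A.
Hypothesis X_indep : forall (s : seq nat) (A : nat -> set V),
  uniq s -> (forall t, t \in s -> (0 < t)%N) -> (forall t, measurable (A t)) ->
  P (\bigcap_(t in [set` s]) X t @^-1` A t) =
    (\prod_(t <- s) P (X t @^-1` A t))%E.
Variable h : V -> R.
Hypotheses (mh : measurable_fun setT h)
  (h01 : {ae nu, forall x, 0 <= h x <= 1}).
Local Notation history n := (g_sigma_algebraType (cylinder X n)).

Lemma ae_law (Q : V -> Prop) t : (0 < t)%N ->
  {ae nu, forall x, Q x} -> {ae P, forall w, Q (X t w)}.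
Proof.
move=> t0 [N [mN nuN QN]]; exists (X t @^-1` N); split.
- exact: measurable_funPTI.
- by rewrite -nuN -(X_law t0 mN).
- by move=> w /= Qw; apply: QN.
Qed.

(** With [E] the event that a given arm is played in round n + 1, this replaces a reward by its
    mean. Clipping supplies the everywhere nonnegative function that [history_ge0_expectation]
    requires. *)
Lemma history_expectation_indic n (E : set Omega) : <<s cylinder X n >> E ->
  (\int[P]_w (\1_E w * h (X n.+1 w))%:E = P E * (\int[nu]_x h x)%:E)%E.
Proof.
move=> hE; have mE := history_measurable hE; have mc := measurable_clip01 mh.
have hc : {ae nu, forall x, h x = clip01 (h x)}.
  by apply: filterS h01 => x hx; rewrite clip01_id.
have mind (g : V -> R) : measurable_fun setT g ->
    measurable_fun setT (fun w => (\1_E w * g (X n.+1 w))%:E).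
  move=> mg; apply/measurable_EFinP/measurable_funM => //.
  exact: measurableT_comp.
rewrite (@ae_eq_integral _ _ _ P setT
  (fun w => (\1_E w * clip01 (h (X n.+1 w)))%:E)) //.
- have -> := @history_ge0_expectation _ _ _ _ _ P nu X X_law X_indep n
    (\1_E : history n -> R) (clip01 \o h) _ mc.
  + rewrite integral_indic // setIT; congr (_ * _)%E.
    rewrite /Rintegral fineK; last exact/integrable_fin_num/integrable_ae_unit.
    apply: ae_eq_integral => //; [exact/measurable_EFinP..|].
    by apply: filterS hc => x hx _ /=; rewrite -hx.
  + exact: measurable_indic.
  + by [].
  + by move=> x; have /andP[] := clip01_unit (h x).
- exact: mind.
- exact: (mind (clip01 \o h)).
- by apply: filterS (ae_law (ltn0Sn n) hc) => x hx _ /=; rewrite -hx.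
Qed.

Lemma integrable_indic_reward n (E : set Omega) : <<s cylinder X n >> E ->
  P.-integrable setT (fun w => (\1_E w * h (X n.+1 w))%:E).
Proof.
move=> hE; have mE := history_measurable hE.
apply: (@integrable_ae_unit _ _ _ P (fun w => \1_E w * h (X n.+1 w))).
  by apply: measurable_funM => //; exact: measurableT_comp.
apply: filterS (ae_law (ltn0Sn n) h01) => w /andP[h0 h1].
by rewrite indicE; case: (w \in E); rewrite ?mul1r ?mul0r ?lexx ?ler01 ?h0.
Qed.

Definition centered_sum n (w : Omega) : R :=
  \sum_(1 <= s < n.+1) (h (X s w) - \int[nu]_x h x).

Lemma measurable_centered_sum n :
  measurable_fun [set: history n] (centered_sum n : history n -> R).
Proof.
rewrite /centered_sum; under eq_fun do rewrite big_add1 big_mkord.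
apply: measurable_sum => s; apply: measurable_funB => //.
apply: (measurableT_comp mh); apply: measurable_history_reward.
by rewrite ltn_ord.
Qed.

Lemma centered_sum_measurable n : measurable_fun [set: Omega] (centered_sum n).
Proof.
move=> _ B mB; apply: (@history_measurable _ _ _ _ _ _ X n).
exact: (@measurable_centered_sum n measurableT B mB).
Qed.

Lemma hoeffding_tail n (eps : R) : 0 < eps ->
  (P [set w | (n%:R * eps <= centered_sum n w)%R]
    <= (expR (- (2 * n%:R * eps ^+ 2)))%:E)%E.
Proof.
(* The choice l = 4 eps minimizes l^2 / 8 - l eps, with minimum -2 eps^2. *)
move=> eps0; have l0 : 0 < 4 * eps by rewrite mulr_gt0.
have mgf : (\int[P]_w (expR (4 * eps * centered_sum n w))%:E
    <= (expR (n%:R * ((4 * eps) ^+ 2 / 8)))%:E)%E.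
  elim: n => [|n IH].
    rewrite mul0r expR0; under eq_integral do
      rewrite /centered_sum big_geq // mulr0 expR0.
    by rewrite integral_cst //= probability_setT mule1.
  under eq_integral do rewrite /centered_sum big_nat_recr //= mulrDr expRD.
  (* The increment of round n + 1 is independent of the first n rounds, so the moment generating
     function gains one factor, bounded by [hoeffding_mgf]. *)
  have -> := @history_ge0_expectation _ _ _ _ _ P nu X X_law X_indep n
    (fun w => expR (4 * eps * centered_sum n w))
    (fun x => expR (4 * eps * (h x - \int[nu]_x h x))).
  + have -> : n.+1%:R * ((4 * eps) ^+ 2 / 8) =
        n%:R * ((4 * eps) ^+ 2 / 8) + (4 * eps) ^+ 2 / 8.
      by rewrite -[n.+1%:R]natr1 mulrDl mul1r.
    rewrite expRD EFinM lee_pmul //.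
    * by apply: integral_ge0 => w _; rewrite lee_fin expR_ge0.
    * by apply: integral_ge0 => w _; rewrite lee_fin expR_ge0.
    * by apply: hoeffding_mgf => //; exact: ltW.
  + apply: measurableT_comp => //; apply: measurable_funM => //.
    exact: measurable_centered_sum.
  + apply: measurableT_comp => //; apply: measurable_funM => //.
    exact: measurable_funB.
  + by move=> w; exact: expR_ge0.
  + by move=> w; exact: expR_ge0.
have mZ := centered_sum_measurable n.
pose Z : {RV P >-> R} :=
  HB.pack (centered_sum n) (isMeasurableFun.Build _ _ _ _ _ mZ).
have := @chernoff _ _ _ P Z (4 * eps) (n%:R * eps) l0.
rewrite /mmt_gen_fun unlock; move=> /le_trans; apply.
have -> : expR (- (2 * n%:R * eps ^+ 2)) =
    expR (n%:R * ((4 * eps) ^+ 2 / 8)) * expR (- (4 * eps * (n%:R * eps))).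
  by rewrite -expRD; congr expR; field.
rewrite EFinM lee_pmul2r ?lte_fin ?expR_gt0 //.
by under eq_integral do rewrite /= mulrC.
Qed.

End HistoryBounds.

Section UnitRewards.
Context {R : realType} {d : measure_display} {V : measurableType d}
  (nu : probability V R) (h : V -> R).
Hypothesis mh : measurable_fun setT h.
Hypothesis h01 : {ae nu, forall x, 0 <= h x <= 1}.

Lemma Rintegral_clip01 : \int[nu]_x h x = \int[nu]_x clip01 (h x).
Proof.
congr fine; apply: ae_eq_integral => //.
- exact/measurable_EFinP.
- exact/measurable_EFinP/measurable_clip01.
- by apply: filterS h01 => x hx _ /=; rewrite clip01_id.
Qed.

Lemma ae_mean_unit : 0 <= \int[nu]_x h x <= 1.
Proof.
rewrite Rintegral_clip01.
exact: (@mean_unit _ _ _ nu _ (measurable_clip01 mh)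
  (fun x => clip01_unit (h x))).
Qed.

Lemma mean_onem : \int[nu]_x (1 - h x) = 1 - \int[nu]_x h x.
Proof.
rewrite RintegralB //; last exact: integrable_ae_unit.
  by rewrite Rintegral_cst //= probability_setT mulr1.
exact: finite_measure_integrable_cst.
Qed.

End UnitRewards.

(** * Executions of ELIM *)

Section ElimRun.
Context {R : realType} {K T : nat} (x : nat -> K.-tuple R)
  (S : nat -> {set 'I_K}) (muhat : nat -> 'I_K -> R)
  (m : nat -> 'I_K) (I : nat -> 'I_K).
Hypothesis run : elim_run T x S muhat m I.

(** Defined from the rewards alone and for every arm, whereas [muhat] is determined only on the arms
    still in play. *)
Definition sample_mean (y : nat -> K.-tuple R) (n : nat) (i : 'I_K) : R :=
  n%:R^-1 * \sum_(1 <= s < n.+1) tnth (y s) i.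

(* The paper's rho_{n+1}: the radius for the mean of n >= 1 observations. *)
Definition confidence_radius (n : nat) : R :=
  Num.sqrt (ln (K * T ^ 2)%N%:R / (2 * n%:R)).

(** A survivor of round t + 1 was in play before and is at least [I t.+1], so its reward is revealed
    and the recursion averages all observations. *)
Lemma elim_muhat t i : (t <= T)%N -> i \in S t ->
  muhat t i = sample_mean x t i.
Proof.
case: run => S0 mu0 step; elim: t => [|t IH] tT it.
  by rewrite mu0 /sample_mean big_geq // mulr0.
have [_ SE [_ Imin] muE] := step t.+1 tT.
rewrite (muE _ it) /feedback (Imin _ it) /= IH 1?ltnW //; last first.
  by move: it; rewrite SE inE => /andP[].
rewrite /sample_mean [in RHS]big_nat_recr //= mulrDr.
(* For t = 0 the factor t^-1 of the mean cannot be cancelled, but the sum of past rewards is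
   empty. *)
have [->|t0] := posnP t; first by rewrite big_geq // !mulr0 mul0r !add0r mulrC.
have tn0 : t%:R != 0 :> R by rewrite pnatr_eq0 -lt0n.
have bn0 : t.+1%:R != 0 :> R by rewrite pnatr_eq0.
move: (t%:R : R) (t.+1%:R : R) tn0 bn0 => a b a0 b0.
by field; rewrite a0 b0.
Qed.

(** Being within the threshold of the maximizer amounts to being within it of every survivor. This
    removes [m], so survival is a function of the rewards whatever the tie-breaking. *)
Lemma elim_survivors t : (t < T)%N -> S t.+1 =
  [set i in S t | (t == 0%N) || [forall j in S t,
     sample_mean x t j - sample_mean x t i <= 2 * confidence_radius t]]%SET.
Proof.
case: run => _ _ step tT; have [[mS mmax] SE _ _] := step t.+1 tT.
rewrite SE; apply/setP => i; rewrite !inE; apply: andb_id2l => iS /=.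
rewrite /rho ltnS leqn0; case: eqP => [->|/eqP t0] /=.
  (* The infinite radius of round 1 eliminates no arm. *)
  by rewrite gt0_muley ?lte_fin // leey.
rewrite -EFinM lee_fin; apply/idP/forall_inP => [h j jS|/(_ _ mS)].
  by rewrite -!elim_muhat 1?ltnW // (le_trans _ h) // lerD2r mmax.
by rewrite -!elim_muhat // ltnW.
Qed.

Lemma elim_played t : (t < T)%N ->
  I t.+1 \in S t.+1 /\ forall j, j \in S t.+1 -> (I t.+1 <= j)%N.
Proof. by case: run => _ _ step tT; have [_ _ []] := step t.+1 tT. Qed.

Lemma elim_playedP t (a : 'I_K) : (t < T)%N ->
  (I t.+1 == a) =
    (a \in S t.+1) && [forall j : 'I_K, (j < a)%N ==> (j \notin S t.+1)].
Proof.
move=> tT; have [IS Imin] := elim_played tT.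
apply/eqP/andP => [<-|[aS /forallP amin]].
  split=> //; apply/forallP => j; apply/implyP => jI.
  by apply: contraL jI => /Imin; rewrite -leqNgt.
apply/val_inj/eqP; rewrite eqn_leq Imin //= leqNgt.
by apply/negP => Ia; have := amin (I t.+1); rewrite Ia IS.
Qed.

Section Concentrated.
Variables (mu : 'I_K -> R) (istar : 'I_K).
Hypothesis best : forall i, mu i <= mu istar.
Hypothesis conc : forall n i, (0 < n < T)%N ->
  `|sample_mean x n i - mu i| <= confidence_radius n.

(** The empirical lead of any survivor over [istar] is at most two radii, one for each estimate,
    which is the elimination threshold. *)
Lemma elim_best_survives t : (t <= T)%N -> istar \in S t.
Proof.
elim: t => [|t IH] tT; first by case: run => -> _ _; rewrite inE.
rewrite elim_survivors // inE IH 1?ltnW //=.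
have [//|t0] := posnP t; apply/forall_inP => j jS.
have h (i : 'I_K) : `|sample_mean x t i - mu i| <= confidence_radius t.
  by apply: conc; rewrite t0.
have := h j; have := h istar; have := best j.
rewrite !ler_norml => bj /andP[h1 h2] /andP[h3 h4]; lra.
Qed.

Lemma elim_played_le t : (t < T)%N -> (I t.+1 <= istar)%N.
Proof. by move=> tT; apply: (elim_played tT).2; exact: elim_best_survives. Qed.

(** [istar] is among the survivors with which the played arm was compared: two radii come from the
    elimination test and one more from each of the two estimates. *)
Lemma elim_played_gap n : (0 < n < T)%N ->
  mu istar - mu (I n.+1) <= 4 * confidence_radius n.
Proof.
move=> nT; have /andP[n0 ltnT] := nT.
have := (elim_played ltnT).1; rewrite elim_survivors // inE => /andP[_].
rewrite (gtn_eqF n0) /= => /forall_inP/(_ _ (elim_best_survives (ltnW ltnT))).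
have := conc istar nT; have := conc (I n.+1) nT; rewrite !ler_norml.
by move=> /andP[h1 h2] /andP[h3 h4] h5; lra.
Qed.

End Concentrated.
End ElimRun.

(** * Gaps in sorted order *)

Section GapBound.
Context {R : realType} {K : nat} (nu : probability (K.-tuple R) R)
  (istar : 'I_K) (delta : seq R) (T : nat).
Hypothesis best : forall i, mean nu i <= mean nu istar.
Hypothesis hdelta : sorted_gaps nu istar delta.
Let C : R := 8 * ln (K * T ^ 2)%N%:R.

Lemma mem_gap (i : 'I_K) : (i <= istar)%N -> gap nu istar i \in delta.
Proof.
case: hdelta => /perm_mem -> _ ii; apply/mapP; exists i => //.
by rewrite mem_filter ii mem_enum.
Qed.

Lemma gap_ge0 (i : 'I_K) : 0 <= gap nu istar i.
Proof. by rewrite subr_ge0. Qed.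

Lemma delta_ge0 : {in delta, forall y, 0 <= y}.
Proof.
case: hdelta => /perm_mem h _ y; rewrite h => /mapP[i _ ->]; exact: gap_ge0.
Qed.

(** The list has at most [istar.+1] entries and contains the gap 0 of [istar], at an index up to
    [istar]; monotonicity carries this 0 to the index [istar]. *)
Lemma delta_istar : delta`_istar = 0.
Proof.
have [p sd] := hdelta.
have szd : (size delta <= istar.+1)%N.
  rewrite (perm_size p) size_map -(size_map (@nat_of_ord K)).
  rewrite -[leqRHS](size_iota 0).
  apply: (@uniq_leq_size _ _ (iota 0 istar.+1)).
    by rewrite (map_inj_uniq (@ord_inj K)) filter_uniq ?enum_uniq.
  move=> _ /mapP[i + ->]; rewrite mem_filter mem_iota => /andP[ii _].
  by rewrite /= add0n ltnS.
have /(nthP 0)[l ld gl] := mem_gap (leqnn istar).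
have li : (l <= istar)%N by rewrite -ltnS (leq_trans ld).
have gl0 : delta`_l = 0 by rewrite gl /gap subrr.
have := nth_sorted_antitone sd delta_ge0 li; rewrite gl0 => di.
apply/eqP; rewrite eq_le di /=.
have [id|id] := ltnP istar (size delta); last by rewrite nth_default.
by rewrite delta_ge0 ?mem_nth.
Qed.

Lemma sum_gaps_le (I : nat -> 'I_K) : (0 < T)%N ->
  (forall t, (t < T)%N -> (I t.+1 <= istar)%N) ->
  (forall n, (0 < n < T)%N -> n%:R * gap nu istar (I n.+1) ^+ 2 <= C) ->
  \sum_(t < T) gap nu istar (I t.+1) <= elim_bound istar delta T - 2.
Proof.
move=> T0 Ile Igap; have C0 : 0 <= C.
  rewrite mulr_ge0 // ln_ge0 // ler1n muln_gt0 expn_gt0 T0 andbT /=.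
  by apply: leq_trans (ltn_ord istar).
have [_ sd] := hdelta.
rewrite -(big_mkord xpredT (fun t => gap nu istar (I t.+1))).
(* Round 1 has no observations behind it and is charged the largest gap; each later round s + 1
   relies on s observations, with s from 1 to T - 1. *)
rewrite big_ltn // /elim_bound addrK -[leRHS]addrA lerD //.
  have /(nthP 0)[l ld <-] := mem_gap (Ile 0%N T0).
  exact: (nth_sorted_antitone sd delta_ge0).
rewrite -[in X in X <= _](prednK T0).
apply: (@sum_sorted_gaps _ delta istar C T.-1 (fun s => gap nu istar (I s.+1)))
  => //; [exact: delta_ge0|exact: delta_istar|].
move=> s /andP[s1 sT]; have {}sT : (s < T)%N by rewrite -(prednK T0) ltnS.
by split; [apply/mem_gap/Ile | apply: Igap; rewrite s1].
Qed.

(** The sequence that always plays [istar] meets the conditions of [sum_gaps_le] with total gap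
    0. *)
Lemma elim_bound_ge2 : (0 < T)%N -> 0 <= elim_bound istar delta T - 2.
Proof.
move=> T0.
apply: le_trans (@sum_gaps_le (fun=> istar) T0 _ _) => //.
  by apply: sumr_ge0 => t _; exact: gap_ge0.
move=> n _; rewrite /gap subrr expr0n mulr0 mulr_ge0 // ln_ge0 // ler1n.
by rewrite muln_gt0 expn_gt0 T0 (leq_trans _ (ltn_ord istar)).
Qed.

End GapBound.

(** * Regret of ELIM *)

Section ElimRegret.
Context {R : realType} {K T : nat} (nu : probability (K.-tuple R) R)
  (istar : 'I_K) {d : measure_display} {Omega : measurableType d}
  (P : probability Omega R) (X : nat -> {RV P >-> K.-tuple R})
  (S : Omega -> nat -> {set 'I_K}) (muhat : Omega -> nat -> 'I_K -> R)
  (m : Omega -> nat -> 'I_K) (played : Omega -> nat -> 'I_K).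
Hypothesis hnu : rewards_in_unit_cube nu.
Hypothesis hbest : forall i : 'I_K, mean nu i <= mean nu istar.
Hypothesis hX : iid_rewards nu X.
Hypothesis hrun : forall w,
  elim_run T (fun t => X t w) (S w) (muhat w) (m w) (played w).
Hypothesis T0 : (0 < T)%N.

Local Notation history n := (g_sigma_algebraType (cylinder X n)).
Local Notation arm i := (fun x : K.-tuple R => tnth x i).

Lemma arm_unit (i : 'I_K) : {ae nu, forall x, 0 <= tnth x i <= 1}.
Proof.
pose cube := [set x : K.-tuple R | forall i, 0 <= tnth x i <= 1].
have mcube : measurable cube.
  have -> : cube = \bigcap_(j in [set: 'I_K]) (arm j @^-1` `[0, 1]).
    apply/seteqP; split => x /= hx j; first by rewrite /= in_itv /= hx.
    by have := hx j I; rewrite /= in_itv.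
  apply: fin_bigcap_measurable => // j _.
  rewrite -[X in measurable X]setTI.
  exact: (measurable_tnth j measurableT).
apply: (@filterS _ _ _ cube) => [x cx|]; first exact: cx.
exists (~` cube); split => //; first exact: measurableC.
rewrite probability_setC // -[nu cube]/(nu [set x | _]) hnu subee //.
Qed.

(** * Measurability of the plays *)

Lemma measurable_sample_mean n t (i : 'I_K) : (t <= n)%N ->
  measurable_fun [set: history n]
    ((fun w => sample_mean (fun s => X s w) t i) : history n -> R).
Proof.
move=> tn; apply: measurable_funM => //.
under eq_fun do rewrite big_add1 big_mkord.
apply: measurable_sum => s; apply: (measurableT_comp (measurable_tnth i)).
by apply: measurable_history_reward; rewrite /= (leq_trans (ltn_ord s)).
Qed.

(** Membership in S_t is decided by the first t - 1 observations, whence the range t <= n + 1; the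
    induction follows [elim_survivors]. *)
Lemma measurable_survival n t (i : 'I_K) : (t <= n.+1)%N -> (t <= T)%N ->
  measurable [set w : history n | i \in S w t].
Proof.
elim: t i => [|t IH] i tn tT.
  rewrite [X in measurable X](_ : _ = setT) //.
  by apply/seteqP; split => // w _ /=; have [-> _ _] := hrun w; rewrite inE.
have {}IH j : measurable [set w : history n | j \in S w t].
  by apply: IH; exact: ltnW.
have msm j := @measurable_sample_mean n t j tn.
(* The comparison with all survivors is an intersection over all arms, an eliminated arm imposing no
   condition. *)
rewrite [X in measurable X](_ : _ = [set w : history n | i \in S w t] `&`
   \bigcap_(j in [set: 'I_K]) (~` [set w : history n | j \in S w t] `|`
     [set w : history n | (t == 0%N) ||
        (sample_mean (fun s => X s w) t j - sample_mean (fun s => X s w) t i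
           <= 2 * @confidence_radius R K T t)])).
  apply: measurableI => //; apply: fin_bigcap_measurable => // j _.
  apply: measurableU; first exact: measurableC.
  case: eqP => _ /=.
    by rewrite [X in measurable X](_ : _ = setT) //; apply/seteqP.
  rewrite -[X in measurable X]setTI.
  apply: measurable_fun_le => //.
  by apply: measurable_funB; exact: msm.
apply/seteqP; split => w /=; rewrite (elim_survivors (hrun w) tT) !inE.
  move=> /andP[iS h]; split => // j _ /=; have [jS|jS] := boolP (j \in S w t).
    right; move: h; case: eqP => //= _ /forall_inP; exact.
  by left; apply/negP.
move=> [-> h] /=; case: eqP h => //= t0 h; apply/forall_inP => j jS.
by have [jn|hj] := h j I; [case: jn | exact: hj].
Qed.

(** The arm of round t + 1 is decided by the first t observations, which makes the choice
    independent of the reward vector of that round. *)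
Lemma measurable_played t (a : 'I_K) : (t < T)%N ->
  measurable [set w : history t | played w t.+1 = a].
Proof.
move=> tT.
rewrite [X in measurable X](_ : _ = [set w : history t | a \in S w t.+1] `&`
   \bigcap_(j in [set j : 'I_K | (j < a)%N])
     ~` [set w : history t | j \in S w t.+1]).
  apply: measurableI; first exact: measurable_survival.
  apply: fin_bigcap_measurable => // j _.
  by apply: measurableC; exact: measurable_survival.
apply/seteqP; split => w /=.
  move=> /eqP; rewrite (elim_playedP (hrun w)) // => /andP[aS /forallP h].
  by split => // j ja /=; apply/negP; apply: (implyP (h j)).
move=> [aS h]; apply/eqP; rewrite (elim_playedP (hrun w)) // aS /=.
by apply/forallP => j; apply/implyP => ja; apply/negP/h.
Qed.

(** * Probability of a deviation *)

Definition deviation n i : set Omega :=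
  [set w | ~~ (`|sample_mean (fun s => X s w) n i - mean nu i|
      <= @confidence_radius R K T n)].

Lemma deviation_measurable n i : measurable (deviation n i).
Proof.
apply: (@history_measurable _ _ _ _ _ _ X n).
have -> : deviation n i = ~` [set w : history n |
    `|sample_mean (fun s => X s w) n i - mean nu i|
      <= @confidence_radius R K T n].
  by apply/seteqP; split => w /= /negP.
apply: (@measurableC _ (history n)); rewrite -[X in measurable X]setTI.
apply: measurable_fun_le => //; apply: measurableT_comp => //.
by apply: measurable_funB => //; exact: measurable_sample_mean.
Qed.

Lemma centered_sum_arm n i w : (0 < n)%N ->
  centered_sum nu X (arm i) n w =
    n%:R * (sample_mean (fun s => X s w) n i - mean nu i).
Proof.
move=> n0; rewrite /centered_sum sumrB sumr_const_nat subn1 /= /sample_mean.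
by rewrite mulrBr mulVKf ?pnatr_eq0 -?lt0n // mulr_natl.
Qed.

(** The values 1 - x_i also lie in [0, 1] almost surely, so Hoeffding's upper tail for them is the
    lower tail for arm i. *)
Lemma centered_sum_onem n i w :
  centered_sum nu X (fun x => 1 - tnth x i) n w =
    - centered_sum nu X (arm i) n w.
Proof.
rewrite /centered_sum (mean_onem (measurable_tnth i) (arm_unit i)) -sumrN.
by apply: eq_bigr => s _; ring.
Qed.

Lemma deviation_prob n i : (0 < n < T)%N ->
  (P (deviation n i) <= (2 / (K * T ^ 2)%N%:R)%:E)%E.
Proof.
move=> /andP[n0 nT]; set L := ln (K * T ^ 2)%N%:R : R.
(* The range of [n] forces T >= 2, so the logarithm and the radius are positive, as [hoeffding_tail]
   requires. *)
have KT1 : (1 < K * T ^ 2)%N.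
  have T1 : (1 < T)%N by exact: leq_trans nT.
  apply: (leq_trans T1); rewrite expnS expn1 mulnA leq_pmull // muln_gt0 T0.
  by rewrite (leq_trans _ (ltn_ord istar)).
have L0 : 0 < L by rewrite ln_gt0 // ltr1n.
have r0 : 0 < @confidence_radius R K T n.
  by rewrite sqrtr_gt0 divr_gt0 // mulr_gt0 // ltr0n.
(* The squared radius is ln (K T^2) / (2 n), so each tail bound equals 1 / (K T^2). *)
have LE : expR (- (2 * n%:R * @confidence_radius R K T n ^+ 2)) =
    (K * T ^ 2)%N%:R^-1.
  rewrite sqr_sqrtr; last by rewrite divr_ge0 ?mulr_ge0 // ltW.
  rewrite mulrCA divff ?mulr1 ?expRN ?lnK //.
  - by rewrite posrE ltr0n ltnW.
  - by rewrite mulf_neq0 // pnatr_eq0 -lt0n.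
have [law indep] := hX.
have mi := measurable_tnth i : measurable_fun [set: K.-tuple R] (arm i).
have ui := arm_unit i.
have mi' : measurable_fun [set: K.-tuple R] (fun x => 1 - tnth x i).
  exact: measurable_funB.
have ui' : {ae nu, forall x, 0 <= 1 - tnth x i <= 1}.
  by apply: filterS ui => x /andP[? ?]; rewrite subr_ge0 gerBl; apply/andP.
have up := hoeffding_tail law indep mi ui n r0.
have dn := hoeffding_tail law indep mi' ui' n r0.
rewrite LE in up dn.
set U := [set w | _] in up; set D := [set w | _] in dn.
have mtail h : measurable_fun setT h -> measurable
    [set w | n%:R * @confidence_radius R K T n <= centered_sum nu X h n w].
  move=> mh; rewrite -[X in measurable X]setTI.
  by apply: measurable_fun_le => //; exact: centered_sum_measurable.
have mU : measurable U by exact: mtail.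
have mD : measurable D by exact: mtail.
apply: (@le_trans _ _ (P (U `|` D))).
  apply: le_measure; rewrite ?inE //.
  - exact: deviation_measurable.
  - exact: measurableU.
  move=> w; rewrite /deviation /= -ltNge ltr_normr /U /D /=.
  rewrite centered_sum_onem centered_sum_arm // -mulrN !ler_pM2l ?ltr0n //.
  by move=> /orP[/ltW|/ltW]; [left|right].
apply: (le_trans (measureU2 _ mU mD)).
have -> : (2 / (K * T ^ 2)%N%:R)%:E =
  ((K * T ^ 2)%N%:R^-1%:E + (K * T ^ 2)%N%:R^-1%:E)%E :> \bar R.
  by rewrite -EFinD mulrDl mul1r.
exact: leeD.
Qed.

(** * From the realized regret to the gaps *)

Definition play_event (p : 'I_T * 'I_K) : set Omega :=
  [set w | played w p.1.+1 = p.2].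

Lemma play_event_history (p : 'I_T * 'I_K) :
  <<s cylinder X p.1 >> (play_event p).
Proof. exact: measurable_played. Qed.

Lemma sum_play_event (t : 'I_T) w (u : 'I_K -> R) :
  \sum_(a : 'I_K) \1_(play_event (t, a)) w * u a = u (played w t.+1).
Proof.
rewrite (bigD1 (played w t.+1)) //= big1 ?addr0 => [|a /eqP aw].
  by rewrite indicE mem_set ?mul1r.
by rewrite indicE memNset ?mul0r // => /esym.
Qed.

(** The regret is split over pairs of a round and an arm. For each pair the play event is determined
    by earlier rounds, so the realized difference can be replaced by its mean, the gap. *)
Lemma regret_gap :
  regret X istar played T =
    (\int[P]_w (\sum_(t < T) gap nu istar (played w t.+1))%:E)%E.
Proof.
have [law indep] := hX.
pose F (p : 'I_T * 'I_K) w := \1_(play_event p) w * tnth (X p.1.+1 w) istar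
  - \1_(play_event p) w * tnth (X p.1.+1 w) p.2.
pose G (p : 'I_T * 'I_K) w := \1_(play_event p) w * gap nu istar p.2.
have mE p : measurable (play_event p).
  apply: (@history_measurable _ _ _ _ _ _ X p.1).
  exact: play_event_history.
have intE (p : 'I_T * 'I_K) i : P.-integrable setT
    (fun w => (\1_(play_event p) w * tnth (X p.1.+1 w) i)%:E).
  exact: (@integrable_indic_reward _ _ _ _ _ P nu X law (arm i)
    (measurable_tnth i) (arm_unit i) p.1 _ (@play_event_history p)).
have intF p : P.-integrable setT (EFin \o F p).
  exact: (integrableB measurableT (intE p istar) (intE p p.2)).
have intG p : P.-integrable setT (EFin \o G p).
  apply: (@integrableZr _ _ _ P setT measurableT (gap nu istar p.2)
    (EFin \o \1_(play_event p))).
  exact: integrable_indic.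
have FG p : (\int[P]_w (F p w)%:E = \int[P]_w (G p w)%:E)%E.
  rewrite /F integralB_EFin //; last 2 first.
  - exact: intE.
  - exact: intE.
  have expE i : (\int[P]_w (\1_(play_event p) w * tnth (X p.1.+1 w) i)%:E =
      P (play_event p) * (mean nu i)%:E)%E.
    exact: (@history_expectation_indic _ _ _ _ _ P nu X law indep (arm i)
      (measurable_tnth i) (arm_unit i) p.1 _ (@play_event_history p)).
  rewrite !expE.
  rewrite /G; under [RHS]eq_integral do rewrite EFinM.
  rewrite integralZr //; last exact: integrable_indic.
  rewrite integral_indic // setIT -(fineK (fin_num_measure P _ (mE p))).
  by rewrite -!EFinM -EFinB -mulrBr EFinM fineK ?fin_num_measure.
rewrite /regret unlock.
transitivity (\int[P]_w (\sum_p (F p w)%:E))%E.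
  apply: eq_integral => w _; rewrite sumEFin; congr EFin.
  rewrite -(pair_bigA _ (fun t a => F (t, a) w)) big_add1 big_mkord.
  apply: eq_bigr => t _; rewrite sumrB sum_play_event.
  by rewrite (sum_play_event t w (fun=> _)).
transitivity (\int[P]_w (\sum_p (G p w)%:E))%E; last first.
  apply: eq_integral => w _; rewrite sumEFin; congr EFin.
  rewrite -(pair_bigA _ (fun t a => G (t, a) w)).
  by apply: eq_bigr => t _; rewrite sum_play_event.
rewrite (integral_sum measurableT intF) (integral_sum measurableT intG).
by apply: eq_bigr => p _; exact: FG.
Qed.

(** * Bound on each trajectory and in expectation *)

Lemma confidence_radius_gap n (g : R) : (0 < n)%N -> 0 <= g ->
  g <= 4 * @confidence_radius R K T n ->
  n%:R * g ^+ 2 <= 8 * ln (K * T ^ 2)%N%:R.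
Proof.
move=> n0 g0 gr; have L0 : 0 <= ln (K * T ^ 2)%N%:R :> R.
  rewrite ln_ge0 // ler1n muln_gt0 expn_gt0 T0 andbT.
  exact: leq_ltn_trans (ltn_ord istar).
have nn0 : n%:R != 0 :> R by rewrite pnatr_eq0 -lt0n.
(* The square of four radii is 16 ln (K T^2) / (2 n), the origin of the constant 8 in C. *)
have -> : 8 * ln (K * T ^ 2)%N%:R =
    n%:R * (4 * @confidence_radius R K T n) ^+ 2.
  rewrite exprMn sqr_sqrtr ?divr_ge0 ?mulr_ge0 //.
  by field.
by rewrite ler_wpM2l // ler_pXn2r // nnegrE (le_trans g0).
Qed.

Lemma gap_le1 (i : 'I_K) : gap nu istar i <= 1.
Proof.
have /andP[_ h1] := ae_mean_unit (measurable_tnth istar) (arm_unit istar).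
have /andP[h2 _] := ae_mean_unit (measurable_tnth i) (arm_unit i).
by rewrite /gap /mean; lra.
Qed.

(** No concentration is claimed for zero observations, where the radius reads as 0, so the index 0
    gets the empty event. *)
Definition bad_event (p : 'I_T * 'I_K) : set Omega :=
  if (0 < p.1)%N then deviation p.1 p.2 else set0.

Lemma bad_event_measurable p : measurable (bad_event p).
Proof.
by rewrite /bad_event; case: ifP => _; [exact: deviation_measurable|].
Qed.

(** A pathwise union bound: on a bad event the gaps sum to at most T and some indicator is 1;
    otherwise every mean is within its radius and [sum_gaps_le] applies. *)
Lemma regret_pathwise delta (hdelta : sorted_gaps nu istar delta) w :
  \sum_(t < T) gap nu istar (played w t.+1) <= elim_bound istar delta T - 2
    + T%:R * \sum_(p : 'I_T * 'I_K) \1_(bad_event p) w.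
Proof.
have D0 := elim_bound_ge2 hbest hdelta T0.
have s0 : 0 <= \sum_(p : 'I_T * 'I_K) \1_(bad_event p) w :> R.
  exact: sumr_ge0.
have [/existsP[p wp]|/existsPn good] := boolP [exists p, w \in bad_event p].
  apply: (@le_trans _ _ T%:R).
    have -> : T%:R = \sum_(t < T) 1 :> R by rewrite sumr_const card_ord.
    by apply: ler_sum => t _; exact: gap_le1.
  apply: (@le_trans _ _ (T%:R * \sum_(p : 'I_T * 'I_K) \1_(bad_event p) w)).
    rewrite -[leLHS]mulr1 ler_wpM2l // (bigD1 p) //= indicE wp lerDl.
    exact: sumr_ge0.
  by rewrite lerDr.
have conc n (i : 'I_K) : (0 < n < T)%N ->
    `|sample_mean (fun s => X s w) n i - mean nu i|
      <= @confidence_radius R K T n.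
  move=> /andP[n0 nT]; have := good (Ordinal nT, i).
  by rewrite /bad_event /= n0 notin_setE /deviation /= => /negP; rewrite negbK.
apply: (le_trans (sum_gaps_le hbest hdelta T0 (I := played w) _ _)).
- by move=> t tT; exact: (elim_played_le (hrun w) hbest conc).
- move=> n nT; apply: confidence_radius_gap; first by case/andP: nT.
    exact: gap_ge0.
  exact: (elim_played_gap (hrun w) hbest conc).
- by rewrite lerDl mulr_ge0.
Qed.

Lemma sum_bad_event :
  (\sum_(p : 'I_T * 'I_K) P (bad_event p) <= (2 / T%:R)%:E)%E.
Proof.
have K0 : (0 < K)%N by exact: leq_ltn_trans (ltn_ord istar).
apply: (@le_trans _ _ (\sum_(p : 'I_T * 'I_K) (2 / (K * T ^ 2)%N%:R)%:E)%E).
  apply: lee_sum => -[n i] _; rewrite /bad_event /=; case: ifP => n0.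
    by apply: deviation_prob; rewrite n0 /=.
  by rewrite measure0 lee_fin divr_ge0.
rewrite sumEFin lee_fin sumr_const card_prod !card_ord -mulr_natl.
rewrite !natrM.
have T1 : T%:R != 0 :> R by rewrite pnatr_eq0 -lt0n.
have K1 : K%:R != 0 :> R by rewrite pnatr_eq0 -lt0n.
by rewrite le_eqVlt; apply/orP; left; apply/eqP; field; rewrite T1 K1.
Qed.

Lemma regret_le delta (hdelta : sorted_gaps nu istar delta) :
  (regret X istar played T <= (elim_bound istar delta T)%:E)%E.
Proof.
have mE p : measurable (play_event p).
  by apply: (@history_measurable _ _ _ _ _ _ X p.1); exact: play_event_history.
have mG : measurable_fun setT
    (fun w => \sum_(t < T) gap nu istar (played w t.+1)).
  under eq_fun do under eq_bigr do rewrite -sum_play_event.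
  apply: measurable_sum => t; apply: measurable_sum => a.
  by apply: measurable_funM.
rewrite regret_gap.
apply: (@le_trans _ _ (\int[P]_w (elim_bound istar delta T - 2
    + T%:R * \sum_(p : 'I_T * 'I_K) \1_(bad_event p) w)%:E)%E).
  apply: ge0_le_integral => //.
  - by move=> w _; rewrite lee_fin sumr_ge0 // => t _; exact: gap_ge0.
  - exact/measurable_EFinP.
  - apply/measurable_EFinP/measurable_funD => //; apply: measurable_funM => //.
    by apply: measurable_sum => p; apply/measurable_indic/bad_event_measurable.
  - by move=> w _; rewrite lee_fin; exact: regret_pathwise.
have D0 := elim_bound_ge2 hbest hdelta T0.
pose s w : R := \sum_(p : 'I_T * 'I_K) \1_(bad_event p) w.
have s0 w : 0 <= s w by exact: sumr_ge0.
have ms : measurable_fun setT s.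
  by apply: measurable_sum => p; apply/measurable_indic/bad_event_measurable.
have intS : (\int[P]_w (s w)%:E = \sum_(p : 'I_T * 'I_K) P (bad_event p))%E.
  under eq_integral do rewrite -sumEFin.
  rewrite integral_sum //; last first.
    by move=> p; apply: integrable_indic; exact: bad_event_measurable.
  apply: eq_bigr => p _; rewrite integral_indic ?setIT //.
  exact: bad_event_measurable.
under eq_integral do rewrite EFinD EFinM -/(s _).
rewrite ge0_integralD //; last 2 first.
- by move=> w _; rewrite -EFinM lee_fin mulr_ge0.
- by apply/measurable_EFinP/measurable_funM.
rewrite ge0_integralZl_EFin //; last 2 first.
- by move=> w _; rewrite lee_fin.
- exact/measurable_EFinP.
rewrite intS integral_cst //= probability_setT mule1.
(* The bad events cost at most T times 2 / T, the final term 2 of the bound. *)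
have TD : ((T%:R)%:E * (2 / T%:R)%:E = 2%:E :> \bar R)%E.
  by rewrite -EFinM mulrCA divff ?mulr1 // pnatr_eq0 -lt0n.
have -> : (elim_bound istar delta T)%:E = ((elim_bound istar delta T - 2)%:E
    + (T%:R)%:E * (2 / T%:R)%:E)%E.
  by rewrite TD -EFinD subrK.
by rewrite leeD2l // lee_wpmul2l ?lee_fin // sum_bad_event.
Qed.

End ElimRegret.

Theorem theorem2 (R : realType) (K : nat)
    (nu : probability (K.-tuple R) R)
    (hnu : rewards_in_unit_cube nu)
    (istar : 'I_K)
    (hbest : forall i : 'I_K, mean nu i <= mean nu istar)
    (delta : seq R) (hdelta : sorted_gaps nu istar delta)
    (T : nat) (hT : (0 < T)%N)
    (d : measure_display) (Omega : measurableType d)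
    (P : probability Omega R)
    (X : nat -> {RV P >-> K.-tuple R})
    (hX : iid_rewards nu X)
    (S : Omega -> nat -> {set 'I_K}) (muhat : Omega -> nat -> 'I_K -> R)
    (m : Omega -> nat -> 'I_K) (I : Omega -> nat -> 'I_K)
    (hrun : forall w : Omega,
       elim_run T (fun t => X t w) (S w) (muhat w) (m w) (I w)) :
  (regret X istar I T <= (elim_bound istar delta T)%:E)%E.
Proof. exact: (regret_le hnu hbest hX hrun hT hdelta). Qed.
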